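(* (i) Let $0<\lambda<1/4$. Then, if $n$ is large enough, there exists a sequence $\Sigma=(a_1,\dots,a_n)$ of $\left(\frac{0.22096}{2}\cdot 2^{n}\right)$-bounded integers that is $\mathcal{F}_{\lambda,n}$-sum distinct. (ii) Let $0<\lambda<1/8$. Then, if $n$ is large enough, there exists a sequence $\Sigma=(a_1,\dots,a_n)$ of $\left(\frac{0.22096}{4}\cdot 2^{n}\right)$-bounded integers that is $\mathcal{F}_{\lambda,n}$-sum distinct.
   Context: $\mathcal{F}_{\lambda,n}$ denotes the family of all subsets of $\{1,\dots,n\}$ of size at most $\lambda n$. A sequence $(a_1,\dots,a_n)$ of integers is $M$-bounded (for a real number $M$) if $a_i\in[0,M]$ for all $i$. For $A\subseteq\{1,\dots,n\}$ put $S(A)=\sum_{i\in A}a_i$. The sequence is $\mathcal{F}_{\lambda,n}$-sum distinct if $S(A_1)\neq S(A_2)$ for all distinct $A_1,A_2\in\mathcal{F}_{\lambda,n}$. ''Large enough'' may depend on $\lambda$. The following known theorem (Lunnon), recalled in the paper and not proved there, may be used: there are integers $\overline{c_1}<\dots<\overline{c_{67}}$ such that for every $n\geq 67$ the sequence $c_{1,n},\dots,c_{n,n}$ defined by $c_{i,n}=2^{i-1}$ if $i\leq n-67$ and $c_{i,n}=2^{n-67}\cdot\overline{c_{i-(n-67)}}$ otherwise satisfies $c_{1,n}<c_{2,n}<\dots<c_{n,n}$, has all $2^n$ subset sums distinct, and satisfies $0.22\cdot 2^n<c_{n,n}<0.22096\cdot 2^n$. *)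

(* Defs.v *)
From mathcomp Require Import all_boot all_order all_algebra.
From mathcomp Require Import reals.

Set Implicit Arguments.
Unset Strict Implicit.
Unset Printing Implicit Defensive.

Import Order.TTheory GRing.Theory Num.Theory.

Local Open Scope ring_scope.

(* A sequence (a_1, ..., a_n) is a function a : 'I_n -> int, with a_(i+1)
   given by the value at the ordinal i; subsets of {1, ..., n} are likewise
   shifted to {set 'I_n}. *)

Definition small_sets (R : realType) (lambda : R) (n : nat) :
    {set {set 'I_n}} :=
  [set A : {set 'I_n} | #|A|%:R <= lambda * n%:R].

Definition subset_sum (n : nat) (a : 'I_n -> int) (A : {set 'I_n}) : int :=
  \sum_(i in A) a i.

Definition M_bounded (R : realType) (M : R) (n : nat) (a : 'I_n -> int) : Prop :=
  forall i : 'I_n, 0 <= ((a i)%:~R : R) <= M.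

Definition sum_distinct (n : nat) (F : {set {set 'I_n}}) (a : 'I_n -> int) :
    Prop :=
  forall A1 A2 : {set 'I_n}, A1 \in F -> A2 \in F ->
    A1 <> A2 -> subset_sum a A1 <> subset_sum a A2.

(* The decimal 0.22096, split because a numeral in ring_scope is expanded in
   unary. *)
Definition lunnon_const (R : realType) : R := 22 / 10 ^+ 2 + 96 / 10 ^+ 5.

(* The term c_(i+1, n); the index i is a nat, meaningful for i < n and
   67 <= n. *)
Definition lunnon_seq (cbar : 67.-tuple int) (n i : nat) : int :=
  if (i < n - 67)%N then 2 ^+ i else 2 ^+ (n - 67) * cbar`_(i - (n - 67)).

(* W. F. Lunnon, Integer sets with distinct subset-sums, Math. Comp. 50
   (1988): the numerical input on which the bounds below rest, taken as a
   hypothesis. *)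
Definition lunnon_theorem (R : realType) : Prop :=
  exists cbar : 67.-tuple int,
    sorted <%R cbar /\
    forall n : nat, (67 <= n)%N ->
      [/\ forall i j : nat, (i < j < n)%N ->
            lunnon_seq cbar n i < lunnon_seq cbar n j,
          sum_distinct [set: {set 'I_n}] (fun i : 'I_n => lunnon_seq cbar n i)
        & 22 / 10 ^+ 2 * 2 ^+ n < (lunnon_seq cbar n n.-1)%:~R :> R /\
          (lunnon_seq cbar n n.-1)%:~R < lunnon_const R * 2 ^+ n].

(* Main.v *)
Require Import Defs.
From mathcomp Require Import all_boot all_order all_algebra.
From mathcomp Require Import reals.
From mathcomp Require Import zify ring lra.

(** Both parts are the cases r = 1 and r = 2 of one construction, valid for
    lambda < 1 / (4 r): take Lunnon's sequence of length N = n - r, whose terms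
    are at most 0.22096 / 2 ^ r times 2 ^ n, and append r integers without
    exceeding that bound.

    The point is to append integers whose nonzero signed combinations are all
    expensive to write in binary.  Let k = r * q be about N / 2, and let the
    j-th appended integer be the sum of 4 ^ i over the j-th block of q
    consecutive exponents in [0, k).  A combination of the appended integers
    with coefficients e_j in {-1, 0, 1} then has base-4 digits in {-1, 0, 1},
    and at least q of them are nonzero unless every e_j vanishes.  Read in base
    2, such digits form a non-adjacent form, and a non-adjacent form has minimal
    weight among all signed binary representations; by [signed_weight_ge] this
    minimality already holds modulo 4 ^ k.

    Modulo 4 ^ k the terms of Lunnon's sequence agree with the powers of 2,
    because its 67 exceptional terms are multiples of 2 ^ (N - 67) and
    2 k <= N - 67.  So a collision S(A1) = S(A2) in which A1 and A2 differ at an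
    appended position represents such a combination modulo 4 ^ k by at most
    |A1| + |A2| signed powers of 2, which forces |A1| + |A2| >= q
    ([collision_card_ge]); but q is about n / (2 r), whereas
    |A1| + |A2| <= 2 lambda n.  If A1 and A2 agree at the appended positions,
    the collision takes place inside Lunnon's sequence, so A1 = A2. *)

Import Order.TTheory GRing.Theory Num.Theory.

Local Open Scope ring_scope.

(** * Minimal weight of signed binary representations *)

(** Two binary digits are consumed for each base-4 digit [s i], and the part
    that does not match is pushed to the next position as a carry.  The cost of
    one step is controlled by the identity c + d 0 + 2 d 1 = s 0 + 4 c', which
    for |s 0| <= 1 gives |s 0| + |c'| <= |c| + |d 0| + |d 1|; the carry [c] is in
    the statement for the sake of this induction. *)
Lemma signed_weight_ge (k l : nat) (c : int) (d s : nat -> int) :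
    (forall i, `|s i| <= 1) ->
    (4 ^+ k %| c + \sum_(i < k.*2 + l) d i * 2 ^+ i
                 - \sum_(i < k) s i * 4 ^+ i)%Z ->
  \sum_(i < k) `|s i| <= `|c| + \sum_(i < k.*2 + l) `|d i|.
Proof.
elim: k c d s => [|k IHk] c d s s1.
  by move=> _; rewrite big_ord0 addr_ge0 // sumr_ge0.
rewrite doubleS !addSn.
rewrite !big_ord_recl /= !expr0 !mulr1 => /dvdzP[u].
have -> : \sum_(i < k.*2 + l) d (bump 0 (bump 0 i)) * 2 ^+ bump 0 (bump 0 i)
          = 4 * \sum_(i < k.*2 + l) d i.+2 * 2 ^+ i.
  rewrite mulr_sumr; apply: eq_bigr => i _.
  by rewrite /bump /= !add1n !exprS; ring.
have -> : \sum_(i < k) s (bump 0 i) * 4 ^+ bump 0 i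
          = 4 * \sum_(i < k) s i.+1 * 4 ^+ i.
  rewrite mulr_sumr; apply: eq_bigr => i _.
  by rewrite /bump /= !add1n !exprS; ring.
set D := \sum_(i < _) _; set S := \sum_(i < k) _.
rewrite /bump /= !add1n expr1 exprS => eqDS.
(* This is the integer that makes the carry identity hold exactly, given that
   [u * 4 ^+ k.+1] is the difference of the two sides. *)
pose c' := u * 4 ^+ k - D + S.
have carry : c + d 0%N + d 1%N * 2 = s 0%N + 4 * c'.
  by rewrite /c'; move: (4 ^+ k) eqDS => p eqDS; lia.
have {IHk} := IHk c' (fun i => d i.+2) (fun i => s i.+1) (fun i => s1 i.+1).
rewrite -/D -/S; have -> : c' + D - S = u * 4 ^+ k by rewrite /c'; ring.
move=> /(_ (dvdz_mull _ (dvdzz _))) weight_IH.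
suff : `|s 0%N| + \sum_(i < k) `|s i.+1| <=
    `|c| + (`|d 0%N| + (`|d 1%N| + \sum_(i < k.*2 + l) `|d i.+2|)) by [].
by move: (s1 0%N) carry weight_IH; lia.
Qed.

(** * The appended integers *)

Definition block_sum (q j : nat) : int := \sum_(j * q <= i < j.+1 * q) 4 ^+ i.

Lemma divn_block (q j i : nat) : (j * q <= i < j.+1 * q)%N -> (i %/ q)%N = j.
Proof.
move=> /andP[jq_le_i i_lt_jq].
have q_gt0 : (0 < q)%N by case: (q) i_lt_jq; rewrite ?muln0.
by apply/eqP; rewrite eqn_leq -ltnS leq_divRL // ltn_divLR // i_lt_jq.
Qed.

(** Used both for the value and for the weight of a combination of the block
    sums whose digit at position [i] is the coefficient of the block of [i]. *)
Lemma sum_by_blocks (r q : nat) (F : nat -> nat -> int) :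
  \sum_(i < r * q) F (i %/ q)%N i
    = \sum_(j < r) \sum_(j * q <= i < j.+1 * q) F j i.
Proof.
rewrite -(big_mkord xpredT (fun i => F (i %/ q)%N i)) big_nat_mul big_mkord.
by apply: eq_bigr => j _; apply: eq_big_nat => i /divn_block->.
Qed.

Lemma block_sum_ge0 (q j : nat) : 0 <= block_sum q j.
Proof. by apply: sumr_ge0 => i _; rewrite exprn_ge0. Qed.

Lemma block_sum_le (q j : nat) : block_sum q j <= 4 ^+ (j.+1 * q).
Proof.
rewrite /block_sum.
have : (j * q <= j.+1 * q)%N by rewrite leq_mul2r leqnSn orbT.
elim: (j.+1 * q)%N => [|b IHb]; first by move=> _; rewrite big_geq.
rewrite leq_eqVlt => /predU1P[<-|]; first by rewrite big_geq // exprn_ge0.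
rewrite ltnS => jq_le_b; rewrite big_nat_recr //= exprS.
apply: le_trans (lerD (IHb jq_le_b) (lexx _)) _.
by rewrite -mulr2n -[leLHS]mulr_natl ler_wpM2r // exprn_ge0.
Qed.

Definition extend_by_blocks (N q : nat) (c : nat -> int) (i : nat) : int :=
  if (i < N)%N then c i else block_sum q (i - N).

(** * Collisions after appending the blocks *)

(** Defined on all of [nat], so that the sequence can be cut at position [N]
    without casts between ordinal types. *)
Definition char_fun {n : nat} (A : {set 'I_n}) (i : nat) : bool :=
  i \in [seq val j | j in A].

Lemma char_fun_ord {n : nat} (A : {set 'I_n}) (i : 'I_n) :
  char_fun A i = (i \in A).
Proof. exact/mem_image/val_inj. Qed.

Lemma subset_sum_char (n : nat) (c : nat -> int) (A : {set 'I_n}) :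
  subset_sum (fun i : 'I_n => c i) A = \sum_(i < n) (char_fun A i)%:R * c i.
Proof.
rewrite /subset_sum big_mkcond; apply: eq_bigr => i _ /=.
by rewrite char_fun_ord; case: (i \in A); rewrite ?mul1r ?mul0r.
Qed.

Lemma card_char_fun {n : nat} (A : {set 'I_n}) :
  \sum_(i < n) (char_fun A i)%:R = #|A|%:R :> int.
Proof.
rewrite -sum1_card natr_sum [RHS]big_mkcond; apply: eq_bigr => i _ /=.
by rewrite char_fun_ord; case: (i \in A).
Qed.

Lemma sum_distinct_char (N : nat) (c : nat -> int) (b1 b2 : nat -> bool) :
    sum_distinct [set: {set 'I_N}] (fun i : 'I_N => c i) ->
    \sum_(i < N) (b1 i)%:R * c i = \sum_(i < N) (b2 i)%:R * c i ->
  forall i, (i < N)%N -> b1 i = b2 i.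
Proof.
move=> distinct_c eq_sum i i_lt_N.
have [eqA | /eqP neqA] :=
  eqVneq [set j : 'I_N | b1 j] [set j : 'I_N | b2 j].
  by have /setP/(_ (Ordinal i_lt_N)) := eqA; rewrite !inE.
case: (distinct_c _ _ (in_setT _) (in_setT _) neqA).
rewrite !subset_sum_char; etransitivity; first etransitivity; last 1 first.
- by symmetry; apply: eq_bigr => j _; rewrite char_fun_ord inE.
- by apply: eq_bigr => j _; rewrite char_fun_ord inE.
- exact: eq_sum.
Qed.

(** Let [d] be the difference of the characteristic functions of [A1] and [A2].
    If [d] is nonzero at an appended position, then the collision expresses the
    opposite of the corresponding combination of block sums as the sum of
    [d i * 2 ^+ i] modulo 4 ^ (r q), and at least [q] of the base-4 digits of
    this combination are nonzero. *)
Lemma collision_card_ge (N r q : nat) (c : nat -> int)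
    (A1 A2 : {set 'I_(N + r)}) :
    ((r * q).*2 <= N)%N ->
    (forall i, (i < N)%N -> (4 ^+ (r * q) %| c i - 2 ^+ i)%Z) ->
    sum_distinct [set: {set 'I_N}] (fun i : 'I_N => c i) ->
    A1 <> A2 ->
    subset_sum (fun i : 'I_(N + r) => extend_by_blocks N q c i) A1
      = subset_sum (fun i : 'I_(N + r) => extend_by_blocks N q c i) A2 ->
  (q <= #|A1| + #|A2|)%N.
Proof.
move=> rq_le_N c_mod distinct_c neqA.
rewrite !subset_sum_char.
set b1 := char_fun A1; set b2 := char_fun A2.
pose d i : int := (b1 i)%:R - (b2 i)%:R.
pose e j := d (N + j)%N.
have split_sum (b : nat -> int) :
    \sum_(i < N + r) b i * extend_by_blocks N q c i
      = \sum_(i < N) b i * c i + \sum_(j < r) b (N + j)%N * block_sum q j.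
  rewrite big_split_ord /=; congr (_ + _); apply: eq_bigr => i _.
    by rewrite /extend_by_blocks ltn_ord.
  by rewrite /extend_by_blocks ltnNge leq_addr addKn.
move=> eq_sum.
have d_le1 i : `|d i| <= 1 by rewrite /d; case: (b1 i) (b2 i) => [] [].
have [/forallP /= e0 | /forallPn[/= j0 e_neq0]] :=
  boolP [forall j : 'I_r, e j == 0].
  have eq_b j : (j < r)%N -> b1 (N + j)%N = b2 (N + j)%N.
    move=> j_lt_r; have := e0 (Ordinal j_lt_r); rewrite /e /d /=.
    by case: (b1 _) (b2 _) => [] [].
  case: neqA; apply/setP => i; rewrite -!char_fun_ord -/b1 -/b2.
  have [i_lt_N | N_le_i] := ltnP i N.
    apply: (sum_distinct_char N c b1 b2 distinct_c) => //.
    move: eq_sum.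
    rewrite (split_sum (fun i => (b1 i)%:R)) (split_sum (fun i => (b2 i)%:R)).
    under [X in _ + X = _]eq_bigr => j _ do rewrite eq_b //.
    exact: addIr.
  by rewrite -(subnKC N_le_i) eq_b // ltn_subLR.
have weight_d : \sum_(i < N) `|d i| <= (#|A1| + #|A2|)%:R.
  rewrite natrD -!card_char_fun -big_split /= big_split_ord /=.
  rewrite -[X in X <= _]addr0 lerD //; last first.
    by apply: sumr_ge0 => j _; rewrite -natrD.
  apply: ler_sum => i _; rewrite /d /b1 /b2.
  by case: (char_fun A1 _) (char_fun A2 _) => [] [].
rewrite -(ler_nat int); apply: le_trans weight_d.
have weight_e : q%:R <= \sum_(i < r * q) `|e (i %/ q)%N|.
  rewrite (sum_by_blocks r q (fun j _ => `|e j|)).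
  under eq_bigr do rewrite sumr_const_nat mulSn addnK.
  rewrite (bigD1 j0) //= -[X in X <= _]addr0 lerD //.
    by rewrite lerMn2r -gtz0_ge1 normr_gt0 e_neq0 orbT.
  by apply: sumr_ge0 => j _; rewrite mulrn_wge0.
apply: le_trans weight_e _.
under eq_bigr do rewrite -normrN.
have := signed_weight_ge (r * q) (N - (r * q).*2) 0 d (fun i => - e (i %/ q)%N).
rewrite subnKC // normr0 !add0r => weight_ge; apply: weight_ge => [i|].
  by rewrite normrN; exact: d_le1.
under [X in _ - X]eq_bigr do rewrite mulNr.
rewrite sumrN opprK (sum_by_blocks r q (fun j i => e j * 4 ^+ i)).
under [X in _ + X]eq_bigr do rewrite -mulr_sumr -/(block_sum q _).
have : \sum_(i < N) d i * c i + \sum_(j < r) e j * block_sum q j = 0.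
  rewrite -split_sum; under eq_bigr do rewrite mulrBl.
  by rewrite sumrB eq_sum subrr.
move/eqP; rewrite addrC addr_eq0 => /eqP->.
rewrite -sumrB; apply: rpred_sum => i _.
by rewrite -mulrBr -opprB mulrN rpredN dvdz_mull ?c_mod.
Qed.

(** * Lunnon's sequence *)

Lemma lunnon_seq_mod (cbar : 67.-tuple int) (N k i : nat) :
  (67 <= N)%N -> (k.*2 <= N - 67)%N ->
  (4 ^+ k %| lunnon_seq cbar N i - 2 ^+ i)%Z.
Proof.
move=> N_ge67 k_le; have pow4 m : (k.*2 <= m)%N -> (4 ^+ k %| (2 : int) ^+ m)%Z.
  by move=> k_le_m; rewrite -(subnKC k_le_m) exprD -mul2n exprM dvdz_mulr.
rewrite /lunnon_seq; case: ltnP => [_|N_le_i]; first by rewrite subrr dvdz0.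
by rewrite rpredB ?dvdz_mulr ?pow4 // (leq_trans k_le).
Qed.

(** The sequence increases from its first term, which is 2 ^ 0 once N > 67;
    for N = 67 it would be an unspecified integer of the tuple. *)
Lemma lunnon_seq_ge0 (cbar : 67.-tuple int) (N i : nat) :
    (67 < N)%N ->
    (forall i j : nat, (i < j < N)%N ->
      lunnon_seq cbar N i < lunnon_seq cbar N j) ->
  (i < N)%N -> 0 <= lunnon_seq cbar N i.
Proof.
move=> N_gt67 lunnon_incr i_lt_N.
have c0 : lunnon_seq cbar N 0 = 1 by rewrite /lunnon_seq subn_gt0 N_gt67 expr0.
case: i i_lt_N => [|i] i_lt_N; first by rewrite c0.
by rewrite ltW // (lt_trans _ (lunnon_incr 0 i.+1 _)) ?c0.
Qed.

Lemma lunnon_seq_le (R : realType) (cbar : 67.-tuple int) (N i : nat) (M : R) :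
    (forall i j : nat, (i < j < N)%N ->
      lunnon_seq cbar N i < lunnon_seq cbar N j) ->
    (lunnon_seq cbar N N.-1)%:~R < M ->
  (i < N)%N -> (lunnon_seq cbar N i)%:~R <= M.
Proof.
move=> lunnon_incr top_lt i_lt_N; apply: le_trans (ltW top_lt).
rewrite ler_int; have [->//|i_neq] := eqVneq i N.-1.
by apply/ltW/lunnon_incr; lia.
Qed.

Lemma lunnon_const_ge (R : realType) : 1 / 2 ^+ 3 <= lunnon_const R.
Proof. by rewrite /lunnon_const; lra. Qed.

(** A block sum is at most 2 ^ (N - 67), far below the term bound, for which
    1 / 8 <= 0.22096 leaves enough room. *)
Lemma block_sum_le_lunnon (R : realType) (N r q j : nat) :
    (j < r)%N -> ((r * q).*2 <= N - 67)%N -> (67 <= N)%N ->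
  (block_sum q j)%:~R <= lunnon_const R * 2 ^+ N.
Proof.
move=> j_lt_r rq_le N_ge67.
have pow_le : block_sum q j <= 2 ^+ (N - 3).
  apply: le_trans (block_sum_le q j) _.
  rewrite (_ : 4 = 2 ^+ 2) // -exprM ler_weXn2l // mul2n.
  apply: leq_trans (leq_trans rq_le _); last by rewrite leq_sub2l.
  by rewrite leq_double leq_mul2r j_lt_r orbT.
have : (block_sum q j)%:~R <= (2 : R) ^+ (N - 3).
  by rewrite -[2]/(2%:~R) -rmorphXn ler_int.
move=> /le_trans; apply.
rewrite -[in leRHS](subnKC (leq_trans _ N_ge67 : (3 <= N)%N)) // exprD mulrA.
rewrite ler_peMl ?exprn_ge0 //.
have := lunnon_const_ge R; lra.
Qed.

(** * Large n *)

Lemma sum_distinct_with_blocks (R : realType) (lunnon : lunnon_theorem R)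
    (r : nat) (lambda : R) :
    (0 < r)%N -> 4 * r%:R * lambda < 1 ->
  exists N0 : nat, forall N : nat, (N0 <= N)%N ->
    exists a : 'I_(N + r) -> int,
      M_bounded (lunnon_const R * 2 ^+ N) a /\
      sum_distinct (small_sets lambda (N + r)) a.
Proof.
case: lunnon => cbar [_ cbarP] r_gt0 lambda_lt.
pose gap := 1 - 4 * r%:R * lambda.
have gap_gt0 : 0 < gap by rewrite subr_gt0.
(* [q] is at least (N - 67) / (2 r) - 1, up to strictness, so that
   2 lambda (N + r) < q follows from K < N gap. *)
pose K : R := 4 * r%:R ^+ 2 * lambda + 67 + 2 * r%:R.
have [N1 N1P] : exists N1 : nat, K / gap < N1%:R.
  exists (Num.bound `|K / gap|).
  by rewrite (le_lt_trans (ler_norm _)) // archi_boundP.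
exists (maxn 68 N1) => N; rewrite geq_max => /andP[N_gt67 N1_le_N].
have N_ge67 := ltnW N_gt67.
have [lunnon_incr distinct_c [_ top_lt]] := cbarP N N_ge67.
pose q := ((N - 67) %/ r.*2)%N.
have rq_le : ((r * q).*2 <= N - 67)%N.
  by rewrite doubleMl mulnC leq_trunc_div.
have q_gt : 2 * (lambda * (N + r)%:R) < q%:R.
  have : (N < 67 + q.+1 * r.*2)%N.
    by rewrite -ltn_subLR // -ltn_divLR ?double_gt0.
  rewrite -(ltr_nat R) natrD natrM -muln2 natrM -natr1 => N_lt.
  have : K < N%:R * gap.
    by rewrite -ltr_pdivrMr //; apply: lt_le_trans N1P _; rewrite ler_nat.
  rewrite /K /gap natrD => K_lt.
  have two_r_gt0 : 0 < 2 * r%:R :> R by rewrite mulr_gt0 ?ltr0n.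
  rewrite -(ltr_pM2l two_r_gt0); lra.
exists (fun i => extend_by_blocks N q (lunnon_seq cbar N) i); split.
  move=> i; rewrite /extend_by_blocks; case: ltnP => [i_lt_N | N_le_i].
    by rewrite ler0z lunnon_seq_ge0 // (lunnon_seq_le R cbar N).
  rewrite ler0z block_sum_ge0 (block_sum_le_lunnon R N r) //.
  by rewrite ltn_subLR.
move=> A1 A2; rewrite !inE => small1 small2 neqA eq_sum.
have c_mod i : (i < N)%N ->
    (4 ^+ (r * q) %| lunnon_seq cbar N i - 2 ^+ i)%Z.
  by move=> _; apply: lunnon_seq_mod.
have rq_le_N : ((r * q).*2 <= N)%N := leq_trans rq_le (leq_subr _ _).
have := collision_card_ge N r q _ A1 A2 rq_le_N c_mod distinct_c neqA eq_sum.
rewrite -(ler_nat R) natrD leNgt => /negP.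
by apply; apply: le_lt_trans q_gt; rewrite mulr_natl mulr2n lerD.
Qed.

(** Each appended integer shortens Lunnon's sequence by one term, which halves
    the bound, at the price of a smaller range of [lambda]. *)
Lemma lunnon_bound_improved (R : realType) (lunnon : lunnon_theorem R)
    (r : nat) (lambda : R) :
    (0 < r)%N -> 4 * r%:R * lambda < 1 ->
  exists n0 : nat, forall n : nat, (n0 <= n)%N ->
    exists a : 'I_n -> int,
      M_bounded (lunnon_const R / 2 ^+ r * 2 ^+ n) a /\
      sum_distinct (small_sets lambda n) a.
Proof.
move=> r_gt0 lambda_lt.
have [N0 N0P] := sum_distinct_with_blocks R lunnon r lambda r_gt0 lambda_lt.
exists (N0 + r)%N => n n_ge.
have r_le_n : (r <= n)%N := leq_trans (leq_addl _ _) n_ge.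
have N0_le : (N0 <= n - r)%N by rewrite leq_subRL // addnC.
have := N0P _ N0_le.
suff -> : lunnon_const R / 2 ^+ r * 2 ^+ n = lunnon_const R * 2 ^+ (n - r).
  by rewrite subnK.
rewrite -{1}(subnK r_le_n) exprD mulrAC mulrA mulfK //.
by rewrite expf_neq0 // pnatr_eq0.
Qed.

Theorem theorem3p12 (R : realType) (lunnon : lunnon_theorem R) :
  (forall lambda : R, 0 < lambda < 1 / 4 ->
    exists n0 : nat, forall n : nat, (n0 <= n)%N ->
      exists a : 'I_n -> int,
        M_bounded (lunnon_const R / 2 * 2 ^+ n) a /\
        sum_distinct (small_sets lambda n) a) /\
  (forall lambda : R, 0 < lambda < 1 / 8 ->
    exists n0 : nat, forall n : nat, (n0 <= n)%N ->
      exists a : 'I_n -> int,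
        M_bounded (lunnon_const R / 4 * 2 ^+ n) a /\
        sum_distinct (small_sets lambda n) a).
Proof.
split=> lambda /andP[_ lambda_lt].
- have [|n0 n0P] := lunnon_bound_improved R lunnon 1 lambda isT; first by lra.
  by exists n0; rewrite -[2]expr1.
- have [|n0 n0P] := lunnon_bound_improved R lunnon 2 lambda isT; first by lra.
  by exists n0; rewrite (_ : 4 = 2 ^+ 2) // -natrX.
Qed.
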